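(* Let $\alpha>1$, $\beta>0$, $A_\circ>0$, $R_{\mathrm{x}}>0$, $\lambda_{\mathrm{x}}>0$, $p_{\mathrm{I}}\in[0,1]$. Let $\mathbf{x}_{\mathrm{rx}}=x_{\mathrm{rx}}\mathbf{e}_{\mathrm{x}}$ with $x_{\mathrm{rx}}\in\mathbb{R}$, and let $\mathbf{x}_{\mathrm{tx}}=x_{\mathrm{tx}}\mathbf{e}_{\mathrm{x}}+y_{\mathrm{tx}}\mathbf{e}_{\mathrm{y}}$ with $x_{\mathrm{tx}},y_{\mathrm{tx}}\in\mathbb{R}$, $x_{\mathrm{tx}}y_{\mathrm{tx}}=0$ and $\mathbf{x}_{\mathrm{tx}}\neq\mathbf{x}_{\mathrm{rx}}$. With the suburban path loss $\ell_{\mathrm{pl}}=\ell_{\mathrm{pl}}^{\mathrm{s}}$, put $\zeta_{\mathrm{s}}=\beta^{1/\alpha}\|\mathbf{x}_{\mathrm{rx}}-\mathbf{x}_{\mathrm{tx}}\|$. Then the quantity $\mathcal{P}_\circ(\Phi_{\mathrm{x}})$ (defined in the context) satisfies $$\mathcal{P}_\circ(\Phi_{\mathrm{x}})=\exp\bigl(-p_{\mathrm{I}}\lambda_{\mathrm{x}}\zeta_{\mathrm{s}}\,\mathcal{X}(R_{\mathrm{x}})\bigr),$$ where $$\mathcal{X}(R_{\mathrm{x}})=g_\circ\Bigl(\alpha,\tfrac{R_{\mathrm{x}}+\|\mathbf{x}_{\mathrm{rx}}\|}{\zeta_{\mathrm{s}}}\Bigr)+g_\circ\Bigl(\alpha,\tfrac{R_{\mathrm{x}}-\|\mathbf{x}_{\mathrm{rx}}\|}{\zeta_{\mathrm{s}}}\Bigr)\mathbf{1}_{\|\mathbf{x}_{\mathrm{rx}}\|\le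 R_{\mathrm{x}}}-g_\circ\Bigl(\alpha,-\tfrac{R_{\mathrm{x}}-\|\mathbf{x}_{\mathrm{rx}}\|}{\zeta_{\mathrm{s}}}\Bigr)\mathbf{1}_{\|\mathbf{x}_{\mathrm{rx}}\|>R_{\mathrm{x}}}.$$
   Context: Notation: $\mathbf{e}_{\mathrm{x}}=[1\ 0]^{\mathrm T}$, $\mathbf{e}_{\mathrm{y}}=[0\ 1]^{\mathrm T}$; $\|\cdot\|$ is the Euclidean norm on $\mathbb{R}^2$; $\mathbf{1}_{\mathsf Q}=1$ if statement $\mathsf Q$ is true and $0$ otherwise (a term multiplied by a vanishing indicator is read as $0$). Suburban path loss: $\ell_{\mathrm{pl}}^{\mathrm{s}}(\mathbf{x},\mathbf{x}_{\mathrm{rx}})=A_\circ\|\mathbf{x}_{\mathrm{rx}}-\mathbf{x}\|^{-\alpha}$ for $\mathbf{x}\neq\mathbf{x}_{\mathrm{rx}}$. Interferers: $\Phi_{\mathrm{x}}$ is the set of random points $x\mathbf{e}_{\mathrm{x}}$ on the horizontal road, where the coordinates $x$ form a homogeneous Poisson point process of intensity $p_{\mathrm{I}}\lambda_{\mathrm{x}}$ on $\mathcal{B}_{\mathrm{x}}=\{x\in\mathbb{R}: |x|\le R_{\mathrm{x}}\}$. To each point $\mathbf{x}\in\Phi_{\mathrm{x}}$ is attached a fading variable $\ell_{\mathrm{f}}(\mathbf{x})$; these are i.i.d. exponential of mean $1$ and independent of $\Phi_{\mathrm{x}}$. The normalized aggregate interference is $I(\Phi_{\mathrm{x}})=\sum_{\mathbf{x}\in\Phi_{\mathrm{x}}}\ell_{\mathrm{f}}(\mathbf{x})\,\ell_{\mathrm{pl}}(\mathbf{x},\mathbf{x}_{\mathrm{rx}})$.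 Definition: $\mathcal{P}_\circ(\Phi_{\mathrm{x}})=\mathbb{E}\{\exp(-\beta' I(\Phi_{\mathrm{x}}))\}$, where $\beta'=\beta/\ell_{\mathrm{pl}}(\mathbf{x}_{\mathrm{tx}},\mathbf{x}_{\mathrm{rx}})$. The function $g_\circ$: for $\alpha>0$ and $\vartheta\ge 0$, $g_\circ(\alpha,\vartheta)=\int_0^{\vartheta}\frac{\mathrm{d}u}{1+u^{\alpha}}=\vartheta\,{}_2F_1\bigl(1,\tfrac1\alpha;1+\tfrac1\alpha;-\vartheta^{\alpha}\bigr)$, with ${}_2F_1$ the Gauss hypergeometric function. *)

(* Defs.v *)
From HB Require Import structures.
From mathcomp Require Export all_boot all_order all_algebra.
From mathcomp Require Export finmap.
From mathcomp Require Export all_classical all_reals all_analysis.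

Set Implicit Arguments.
Unset Strict Implicit.
Unset Printing Implicit Defensive.

Export Order.TTheory GRing.Theory Num.Theory.
Export numFieldNormedType.Exports.

Local Open Scope classical_set_scope.
Local Open Scope ring_scope.

Section Geometry.
Context {R : realType}.

Definition e_x : 'cV[R]_2 := delta_mx 0 0.
Definition e_y : 'cV[R]_2 := delta_mx 1 0.

(* The library norm on matrices is the sup norm, hence a separate definition. *)
Definition enorm (x : 'cV[R]_2) : R := Num.sqrt (\sum_i x i 0 ^+ 2).

(* Only meaningful for [x != x_rx]; the formula gives the value 0 at
   [x = x_rx] when [alpha != 0], since [0 `^ (- alpha) = 0]. *)
Definition pathloss_suburban (A0 alpha : R) (x x_rx : 'cV[R]_2) : R :=
  A0 * enorm (x_rx - x) `^ (- alpha).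

Definition g_circ (alpha theta : R) : R :=
  \int[lebesgue_measure]_(u in `[0, theta]) (1 + u `^ alpha)^-1.

Definition calX (alpha zeta : R) (x_rx : 'cV[R]_2) (Rx : R) : R :=
  g_circ alpha ((Rx + enorm x_rx) / zeta)
  + g_circ alpha ((Rx - enorm x_rx) / zeta) * (enorm x_rx <= Rx)%R%:R
  - g_circ alpha (- ((Rx - enorm x_rx) / zeta)) * (enorm x_rx > Rx)%R%:R.

End Geometry.

Section Independence.
Context {R : realType} {d : measure_display} {T : measurableType d}.
Variable P : probability T R.

Definition mutually_independent {d' : measure_display}
    {T' : measurableType d'} {I : choiceType} (Y : I -> T -> T') : Prop :=
  forall (J : {fset I}) (A : I -> set T'), (forall j, measurable (A j)) ->
    (P (\bigcap_(j in [set` J]) Y j @^-1` A j)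
     = \prod_(j <- J) P (Y j @^-1` A j))%E.

Definition independent_systems (F G : set (set T)) : Prop :=
  forall A B, F A -> G B -> (P (A `&` B) = P A * P B)%E.

Definition sigma_seq (Y : nat -> T -> R) : set (set T) :=
  <<s [set E | exists i (B : set R), measurable B /\ E = Y i @^-1` B] >>.

End Independence.

(* A finite point process on [R] is given by its number of points [N] and an
   enumeration [X] of them: its points at the outcome [w] are the [X i w] with
   [i < N w]; the values [X i w] with [N w <= i] are irrelevant. *)
Section PointProcess.
Context {R : realType} {d : measure_display} {T : measurableType d}.
Variable P : probability T R.

Definition pp_count (N : T -> nat) (X : nat -> T -> R) (B : set R) (w : T)
  : nat := (\sum_(i < N w) (X i w \in B))%N.

(* The window [W] is meant to have finite Lebesgue measure. Taking [B] outside
   [W] shows that almost surely all points lie in [W]. The second argument of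
   [poisson_prob] is unused in its definition, and [poisson_prob 0 _] is the
   Dirac mass at 0. *)
Definition homogeneous_poisson (lambda : R) (W : set R)
    (N : T -> nat) (X : nat -> T -> R) : Prop :=
  (forall B : set R, measurable B -> forall U : set nat,
     P (pp_count N X B @^-1` U) =
     poisson_prob (lambda * fine (lebesgue_measure (B `&` W))) 0%N U)
  /\
  (forall (n : nat) (B : 'I_n -> set R), (forall i, measurable (B i)) ->
     trivIset setT B ->
     mutually_independent P (fun i => pp_count N X (B i))).

(* Taking [B = setT] gives the events [i < N], so that [N] is measurable with
   respect to this sigma-algebra. *)
Definition sigma_points (N : T -> nat) (X : nat -> T -> R) : set (set T) :=
  <<s [set E | exists i (B : set R), measurable B /\
         E = [set w | (i < N w)%N /\ B (X i w)]] >>.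

(* [h i] is the mark of the [i]-th point. Since marks are attached through the
   enumeration, they are required to be independent of the enumerated process,
   not merely of the unordered set of its points. *)
Definition iid_exp_marks (N : T -> nat) (X h : nat -> T -> R) : Prop :=
  [/\ mutually_independent P h,
      forall i (B : set R), measurable B ->
        P (h i @^-1` B) = exponential_prob 1 B
    & independent_systems P (sigma_points N X) (sigma_seq h)].

Definition interference (l_pl : 'cV[R]_2 -> 'cV[R]_2 -> R) (x_rx : 'cV[R]_2)
    (N : T -> nat) (X h : nat -> T -> R) (w : T) : R :=
  \sum_(i < N w) h i w * l_pl (X i w *: e_x) x_rx.

Definition P_circ (l_pl : 'cV[R]_2 -> 'cV[R]_2 -> R) (beta : R)
    (x_tx x_rx : 'cV[R]_2) (N : T -> nat) (X h : nat -> T -> R) : \bar R :=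
  let beta' := beta / l_pl x_tx x_rx in
  ('E_P[fun w => expR (- beta' * interference l_pl x_rx N X h w)])%E.

End PointProcess.

(* Main.v *)
(* Condition on the number of points and on the cell of a finite measurable
   partition containing each of them: for a path loss that is constant on the
   cells, averaging over the independent exponential marks replaces
   [exp (- v h)] by [1 / (1 + v)], and the remaining product over the points is
   [\prod_k r_k ^ N_k], where the cell counts [N_k] are independent Poisson
   variables. Hence the Laplace transform is
   [exp (- lambda \int_W (1 - 1 / (1 + v)))]. The true path loss, unbounded at
   the receiver, is an increasing limit of such simple functions, and dominated
   convergence applies on both sides because all integrands lie in [0, 1].
   Substituting [u = (x - x_rx) / zeta_s] gives [calX]. *)
From mathcomp Require Import measurable_realfun ring lra.
Require Import Defs.

Set Implicit Arguments.
Unset Strict Implicit.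
Unset Printing Implicit Defensive.

Local Open Scope classical_set_scope.
Local Open Scope ring_scope.

Import HBNNSimple.


(** * Integration against image laws and product laws *)

(** Linearity carries the hypothesis from indicators to simple functions, and monotone convergence
    carries it to [phi]. The weight [W] can be a density, with [Y] the identity, or a product of
    further factors that are held fixed. *)
Lemma ge0_integral_weighted_comp d d' (T : measurableType d)
    (T' : measurableType d') (R : realType) (mu : {measure set T -> \bar R})
    (nu : {measure set T' -> \bar R}) (W : T -> R) (Y : T -> T') (c : R)
    (phi : T' -> R) :
  measurable_fun setT W -> (forall x, 0 <= W x) -> measurable_fun setT Y ->
  0 <= c ->
  (forall B, measurable B ->
    \int[mu]_x (W x * \1_B (Y x))%:E = c%:E * nu B)%E ->
  measurable_fun setT phi -> (forall y, 0 <= phi y) ->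
  (\int[mu]_x (W x * phi (Y x))%:E = c%:E * \int[nu]_y (phi y)%:E)%E.
Proof.
move=> mW W0 mY c0 H mphi phi0.
have mphiE : measurable_fun setT (EFin \o phi) by exact/measurable_EFinP.
pose g := nnsfun_approx measurableT mphiE.
have gcvg y : ((g n y)%:E @[n --> \oo] --> (phi y)%:E)%E.
  by apply: cvg_nnsfun_approx => // ? _; rewrite lee_fin.
have gnd y : {homo (fun n => g n y) : m n / (m <= n)%N >-> m <= n}.
  by move=> m n mn; exact/lefP/nd_nnsfun_approx.
have mgY n : measurable_fun setT (fun x => g n (Y x)).
  exact: measurableT_comp.
have -> : (\int[nu]_y (phi y)%:E = limn (fun n => \int[nu]_y (g n y)%:E))%E.
  rewrite -monotone_convergence//.
  - by apply: eq_integral => y _; apply/esym/cvg_lim.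
  - by move=> n; apply/measurable_EFinP.
  - by move=> n y _; rewrite lee_fin.
  - by move=> y _ m n mn; rewrite lee_fin gnd.
have -> : (\int[mu]_x (W x * phi (Y x))%:E =
    limn (fun n => \int[mu]_x (W x * g n (Y x))%:E))%E.
  rewrite -monotone_convergence//.
  - apply: eq_integral => x _; apply/esym/cvg_lim => //.
    under eq_fun do rewrite EFinM.
    by rewrite EFinM; apply: cvgeZl.
  - by move=> n; apply/measurable_EFinP; apply: measurable_funM.
  - by move=> n y _; rewrite lee_fin mulr_ge0.
  - by move=> y _ m n mn; rewrite lee_fin ler_wpM2l// gnd.
suff suf n : (\int[mu]_x (W x * g n (Y x))%:E = c%:E * \int[nu]_y (g n y)%:E)%E.
  under eq_fun do rewrite suf.
  apply: limeMl => //.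
  apply: ereal_nondecreasing_is_cvgn => m n mn.
  apply: ge0_le_integral => //; first by move=> y _; rewrite lee_fin.
    exact/measurable_EFinP.
    exact/measurable_EFinP.
  by move=> y _; rewrite lee_fin gnd.
have gE y : g n y = \sum_(r \in range (g n)) r * \1_(g n @^-1` [set r]) y.
  by rewrite fimfunE.
have mi r : measurable (g n @^-1` [set r]) by [].
transitivity (\int[mu]_x \sum_(r \in range (g n))
    (W x * (r * \1_(g n @^-1` [set r]) (Y x)))%:E)%E.
  apply: eq_integral => x _; rewrite fsumEFin//; congr EFin.
  by rewrite gE mulr_fsumr.
have r1 r y : 0 <= r * \1_(g n @^-1` [set r]) y.
  exact: nnfun_muleindic_ge0.
rewrite ge0_integral_fsum//; last 2 first.
- move=> r; apply/measurable_EFinP; apply: measurable_funM => //.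
  apply: measurable_funM => //.
  by apply: measurableT_comp => //; exact: measurable_indic.
- by move=> r x _; rewrite lee_fin mulr_ge0.
transitivity (\sum_(r \in range (g n)) c%:E * (r%:E * nu (g n @^-1` [set r])))%E.
  apply: eq_fsbigr => r /set_mem[y _ gy].
  under eq_integral do rewrite mulrCA EFinM.
  have r0 : 0 <= r by rewrite -gy.
  rewrite ge0_integralZl//.
  - by rewrite H// muleCA.
  - apply/measurable_EFinP; apply: measurable_funM => //.
    by apply: measurableT_comp => //; exact: measurable_indic.
  - by move=> x _; rewrite lee_fin mulr_ge0.
rewrite -ge0_mule_fsumr; last first.
  by move=> r; exact: nnsfun_mulemu_ge0.
congr (_ * _)%E.
rewrite -sintegralE -integralT_nnsfun//.
Qed.

(** Independence is known on events only. The factors are upgraded from indicators to functions one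
    at a time, by [ge0_integral_weighted_comp] with all other factors absorbed into the weight. *)
Lemma ge0_integral_prod_comp d d' (T : measurableType d)
    (T' : measurableType d') (R : realType) (mu : {measure set T -> \bar R})
    (I : choiceType) (s : seq I) (nu : I -> probability T' R) (W : T -> R)
    (Y : I -> T -> T') (c : R) :
  uniq s ->
  measurable_fun setT W -> (forall x, 0 <= W x) ->
  (forall i, measurable_fun setT (Y i)) -> 0 <= c ->
  (forall A : I -> set T', (forall i, measurable (A i)) ->
    \int[mu]_x (W x * \prod_(i <- s) \1_(A i) (Y i x))%:E
    = (c * \prod_(i <- s) fine (nu i (A i)))%:E)%E ->
  forall (phi : I -> T' -> R) (e : I -> R),
  (forall i, measurable_fun setT (phi i)) -> (forall i y, 0 <= phi i y) ->
  (forall i, \int[nu i]_y (phi i y)%:E = (e i)%:E)%E ->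
  (\int[mu]_x (W x * \prod_(i <- s) phi i (Y i x))%:E
   = (c * \prod_(i <- s) e i)%:E)%E.
Proof.
move=> us mW W0 mY c0 H.
(* Induct on the list [t] of the indices whose [phi i] is not an indicator. *)
suff claim (t : seq I) (phi : I -> T' -> R) (e : I -> R) :
    (forall i, measurable_fun setT (phi i)) -> (forall i y, 0 <= phi i y) ->
    (forall i, \int[nu i]_y (phi i y)%:E = (e i)%:E)%E ->
    (forall i, i \in s -> i \notin t ->
      exists2 A, measurable A & phi i = \1_A) ->
    (\int[mu]_x (W x * \prod_(i <- s) phi i (Y i x))%:E
     = (c * \prod_(i <- s) e i)%:E)%E.
  by move=> phi e mphi phi0 he; apply: (claim s phi e mphi phi0 he) => i ->.
elim: t phi e => [|i t IH] phi e mphi phi0 he hA.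
  (* Base case: every factor indexed by [s] is an indicator, so [H] applies. Indices outside [s] do
     not enter the products and receive the arbitrary set [set0]. *)
  have /choice[A hA'] i : exists A, measurable A /\ (i \in s -> phi i = \1_A).
    have [si|/negbTE si] := boolP (i \in s); last by exists set0; split.
    by have [//|A mA ->] := hA i si; exists A.
  rewrite -[RHS](_ : (c * \prod_(i <- s) fine (nu i (A i)))%:E = _); last first.
    congr (_ * _)%:E; apply: eq_big_seq => i si.
    have [mA /(_ si) phiE] := hA' i.
    have := he i; rewrite phiE integral_indic// setIT => ->.
    by [].
  rewrite -H; last by move=> i; have [] := hA' i.
  apply: eq_integral => x _; congr (_ * _)%:E.
  apply: eq_big_seq => i si.
  by have [_ /(_ si) ->] := hA' i.
have [si|nsi] := boolP (i \in s); last first.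
  apply: IH => // j js jt; apply: hA => //; rewrite in_cons negb_or jt andbT.
  by apply: contraNneq nsi => <-.
have e0 j : 0 <= e j.
  by rewrite -lee_fin -he; apply: integral_ge0 => y _; rewrite lee_fin.
have rem_neq j : j \in rem i s -> j == i = false.
  by rewrite mem_rem_uniq// inE => /andP[/negbTE].
pose W' x := W x * \prod_(j <- rem i s) phi j (Y j x).
pose c' := c * \prod_(j <- rem i s) e j.
transitivity (\int[mu]_x (W' x * phi i (Y i x))%:E)%E.
  by apply: eq_integral => x _; rewrite (big_rem i)//= /W' mulrAC mulrA.
rewrite (@ge0_integral_weighted_comp _ _ _ _ _ mu (nu i) W' (Y i) c')//.
- rewrite he -EFinM; congr EFin.
  by rewrite (big_rem i)//= /c' mulrAC mulrA.
- apply: measurable_funM => //; apply: measurable_prod => j _.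
  exact: measurableT_comp.
- by move=> x; rewrite /W' mulr_ge0// prodr_ge0.
- by rewrite /c' mulr_ge0// prodr_ge0.
move=> B mB.
(* Testing the weighted identity on [B] turns the factor at [i] into an indicator, so [i] leaves the
   list of exceptions and the induction hypothesis for [t] applies. *)
pose phi' j := if j == i then \1_B else phi j.
pose e' j := if j == i then fine (nu i B) else e j.
rewrite [X in _ = (_ * X)%E](_ : _ = (fine (nu i B))%:E); last first.
  by rewrite fineK// fin_num_measure.
rewrite -EFinM.
transitivity (\int[mu]_x (W x * \prod_(j <- s) phi' j (Y j x))%:E)%E.
  apply: eq_integral => x _; rewrite (big_rem i)//= /phi' eqxx /W'.
  rewrite mulrAC mulrA; congr (_ * _)%:E.
  by apply: eq_big_seq => j /rem_neq ->.
rewrite (IH phi' e').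
- rewrite (big_rem i)//= /e' eqxx /c'.
  rewrite mulrAC mulrA; congr (_ * _)%:E.
  by apply: eq_big_seq => j /rem_neq ->.
- by move=> j; rewrite /phi'; case: ifP => // _; exact: measurable_indic.
- by move=> j y; rewrite /phi'; case: ifP.
- move=> j; rewrite /phi' /e'; case: eqP => [->|//].
  by rewrite integral_indic// setIT fineK// fin_num_measure.
- move=> j js jt; rewrite /phi'; case: eqP => [_|/eqP ji]; first by exists B.
  by apply: hA => //; rewrite in_cons negb_or ji.
Qed.

(** * Transforms of the exponential and Poisson laws *)

Lemma measurable_expRN (R : realType) (v : R) :
  measurable_fun setT (fun y : R => expR (- (v * y))).
Proof.
have mv : measurable_fun setT (fun y : R => v * y) by exact: mulrl_measurable.
have mNv : measurable_fun setT (fun y : R => - (v * y)).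
  exact: measurableT_comp.
exact: measurableT_comp.
Qed.

(** Exponential tilting: [expR (- (v * y))] times the density of rate 1 is [(1 + v)^-1] times the
    density of rate [1 + v], which has total mass 1. *)
Lemma laplace_exponential (R : realType) (v : R) : 0 <= v ->
  (\int[exponential_prob (1 : R)]_y (expR (- (v * y)))%:E
   = ((1 + v)^-1)%:E)%E.
Proof.
move=> v0.
have v1 : 0 < 1 + v by rewrite ltr_pwDl.
(* Taking the density as weight and the identity as [Y] turns the integral into one against Lebesgue
   measure. *)
rewrite -[LHS]mul1e -(@ge0_integral_weighted_comp _ _ _ _ _ lebesgue_measure
  (exponential_prob (1 : R)) (exponential_pdf 1) id 1)//; last 4 first.
- exact: measurable_exponential_pdf.
- by move=> y; exact: exponential_pdf_ge0.
- move=> B mB; rewrite mul1e /= /exponential_prob [RHS]integral_mkcond.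
  apply: eq_integral => x _; rewrite patchE indicE.
  by case: ifP => _; rewrite ?mulr1 ?mulr0.
- exact: measurable_expRN.
transitivity (\int[lebesgue_measure]_y
    ((1 + v)^-1%:E * (exponential_pdf (1 + v) y)%:E))%E.
  apply: eq_integral => y _; rewrite -EFinM; congr EFin.
  have [y0|y0] := leP 0 y; last by rewrite !lt0_exponential_pdf// mul0r mulr0.
  rewrite !exponential_pdfE// mulrA mulVf ?gt_eqF// !mul1r -expRD.
  by congr expR; rewrite !mulNr mul1r -opprD mulrDl mul1r.
rewrite ge0_integralZl//.
- by rewrite integral_exponential_pdf// mule1.
- by apply/measurable_EFinP; exact: measurable_exponential_pdf.
- by move=> y _; rewrite lee_fin exponential_pdf_ge0// ltW.
- by rewrite lee_fin invr_ge0 ltW.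
Qed.

(** Tilting again: [r ^+ k] times the mass of parameter [l] at [k] is [expR (- (l * (1 - r)))] times
    the mass of parameter [l * r], and the latter masses sum to 1. *)
Lemma pgf_poisson (R : realType) (l r : R) : 0 <= l -> 0 < r ->
  (\int[poisson_prob l 0%N]_k (r ^+ k)%:E = (expR (- (l * (1 - r))))%:E)%E.
Proof.
(* For [l = 0] the law is the Dirac mass at 0 and both sides equal 1. *)
rewrite le_eqVlt => /predU1P[<- _|l0 r0].
  rewrite mul0r oppr0 expR0.
  transitivity (\int[\d_0%N]_k ((r ^+ k)%:E : \bar R))%E.
    by apply: eq_measure_integral => A mA _; rewrite /= /poisson_prob ltxx.
  by rewrite integral_dirac// diracT mul1e.
rewrite (_ : [set: nat] = \bigcup_k [set k]); last first.
  by rewrite bigcup_imset1 image_id.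
rewrite ge0_integral_bigcup//=; last 2 first.
- by move=> k _; rewrite lee_fin exprn_ge0// ltW.
- by move=> i j _ _ [k [-> ->]].
have pmfE k : (\int[poisson_prob l 0%N]_(x in [set k]) (r ^+ x)%:E =
    (expR (- (l * (1 - r))))%:E * (poisson_pmf (l * r) k)%:E)%E.
  transitivity (\int[poisson_prob l 0%N]_(x in [set k]) (r ^+ k)%:E)%E.
    by apply: eq_integral => x; rewrite inE => /= ->.
  rewrite integral_cst//= /poisson_prob l0 esum_set1; last first.
    by rewrite lee_fin poisson_pmf_ge0.
  rewrite -!EFinM /poisson_pmf l0 mulr_gt0//; congr EFin.
  have -> : expR (- l) = expR (- (l * (1 - r))) * expR (- (l * r)).
    by rewrite -expRD; congr expR; rewrite mulrBr mulr1 opprB addrAC subrr add0r.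
  by rewrite exprMn; move: (expR _) (_^-1) (expR _) => a b c; ring.
under eq_eseriesr do rewrite pmfE.
have p0 k : (0 <= (poisson_pmf (l * r) k)%:E)%E.
  by rewrite lee_fin poisson_pmf_ge0.
rewrite nneseriesZl//.
have := @probability_setT _ _ R (poisson_prob (l * r) 0%N).
by rewrite /= /poisson_prob mulr_gt0// -nneseries_esumT// => ->; rewrite mule1.
Qed.

(** * Functions indexed by a random integer *)

Lemma measurable_fun_nat_index d d' (T : measurableType d)
    (T' : measurableType d') (N : T -> nat) (F : nat -> T -> T') :
  measurable_fun setT N -> (forall m, measurable_fun setT (F m)) ->
  measurable_fun setT (fun x => F (N x) x).
Proof.
move=> mN mF _ B mB; rewrite setTI.
rewrite (_ : _ @^-1` B = \bigcup_m (N @^-1` [set m] `&` F m @^-1` B)).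
  apply: bigcupT_measurable => m; apply: measurableI.
    by rewrite -[X in measurable X]setTI; exact: mN.
  by rewrite -[X in measurable X]setTI; exact: mF.
apply/seteqP; split => [x Bx|x [m _ [/= <-]]//].
by exists (N x).
Qed.

(** Reduces a random number of factors to a fixed one: both integrals split over the countably many
    events [N = m]. *)
Lemma eq_integral_nat_index d (T : measurableType d) (R : realType)
    (mu : {measure set T -> \bar R}) (N : T -> nat) (F G : nat -> T -> R) :
  measurable_fun setT N ->
  (forall m, measurable_fun setT (F m)) ->
  (forall m, measurable_fun setT (G m)) ->
  (forall m x, 0 <= F m x) -> (forall m x, 0 <= G m x) ->
  (forall m, \int[mu]_x (\1_(N @^-1` [set m]) x * F m x)%:E =
             \int[mu]_x (\1_(N @^-1` [set m]) x * G m x)%:E)%E ->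
  (\int[mu]_x (F (N x) x)%:E = \int[mu]_x (G (N x) x)%:E)%E.
Proof.
move=> mN.
have mNm m : measurable (N @^-1` [set m]).
  by rewrite -[X in measurable X]setTI; exact: mN.
have slice (H : nat -> T -> R) : (forall m, measurable_fun setT (H m)) ->
    (forall m x, 0 <= H m x) ->
    (\int[mu]_x (H (N x) x)%:E =
     \sum_(m <oo) \int[mu]_x (\1_(N @^-1` [set m]) x * H m x)%:E)%E.
  move=> mH H0.
  rewrite {1}(_ : [set: T] = \bigcup_m (N @^-1` [set m])); last first.
    by apply/seteqP; split => // x _; exists (N x).
  rewrite ge0_integral_bigcup//=.
  - apply: eq_eseriesr => m _; rewrite integral_mkcond.
    apply: eq_integral => x _; rewrite patchE indicE.
    by case: ifPn => [|_]; [rewrite inE/= => ->; rewrite mul1r|rewrite mul0r].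
  - apply/measurable_EFinP; apply: measurable_funTS.
    exact: measurable_fun_nat_index.
  - by move=> x _; rewrite lee_fin.
  - by move=> i j _ _ [x [/= -> ->]].
move=> mF mG F0 G0 H; rewrite !slice//.
by apply: eq_eseriesr => m _.
Qed.

(** * Independence of finite families *)

Lemma mutually_independent_inj (R : realType) d (T : measurableType d)
    (P : probability T R) d' (T' : measurableType d') (I J : choiceType)
    (Y : I -> T -> T') (g : J -> I) :
  injective g -> mutually_independent P Y -> mutually_independent P (Y \o g).
Proof.
move=> ginj hY K A mA.
(* By injectivity [A'] is [A j] at [g j]; off the range of [g] its condition is vacuous and it is
   [setT]. *)
pose A' i := [set y | forall j, g j = i -> A j y].
have A'g j : A' (g j) = A j.
  by apply/seteqP; split => [y /(_ j erefl)//|y Ay k /ginj ->].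
have mA' i : measurable (A' i).
  have [[j <-]|ni] := pselect (exists j, g j = i); first by rewrite A'g.
  rewrite (_ : A' i = setT)//; apply/seteqP; split => // y _ j gj.
  by case: ni; exists j.
have := hY [fset g j | j in K]%fset A' mA'.
rewrite big_imfset/=; last by move=> ? ? _ _ /ginj.
under eq_bigr do rewrite A'g.
move=> <-; congr (P _); apply/seteqP; split => [x H i /= /imfsetP[j jK ->]|].
  by rewrite /preimage /= A'g; exact: H.
move=> x H j jK /=; have := H (g j); rewrite /= A'g; apply.
by rewrite in_imfset.
Qed.

(** Passes from the finite sets of the definition to duplicate-free lists such as [index_enum],
    since the two enumerations are permutations of each other. *)
Lemma mutually_independent_seq (R : realType) d (T : measurableType d)
    (P : probability T R) d' (T' : measurableType d') (I : choiceType)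
    (Y : I -> T -> T') (s : seq I) (A : I -> set T') :
  mutually_independent P Y -> uniq s -> (forall i, measurable (A i)) ->
  (P (\bigcap_(i in [set` s]) Y i @^-1` A i)
   = \prod_(i <- s) P (Y i @^-1` A i))%E.
Proof.
move=> hY us mA.
have sE : perm_eq (seq_fset tt s) s.
  by rewrite (perm_trans (seq_fset_perm _ _))// undup_id.
rewrite -(perm_big _ sE) -hY//; congr (P _).
by apply/seteqP; split => x H i /= si; apply: H; rewrite /= ?(perm_mem sE)// -(perm_mem sE).
Qed.

Lemma prod_indic (R : realType) (T T' : Type) (I : eqType)
    (s : seq I) (Y : I -> T -> T') (A : I -> set T') (x : T) :
  \prod_(i <- s) \1_(A i) (Y i x)
  = \1_(\bigcap_(i in [set` s]) Y i @^-1` A i) x :> R.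
Proof.
rewrite indicE; have [H|H] := boolP (x \in _).
  rewrite big_seq big1// => i si; rewrite indicE mem_set//.
  by move: H; rewrite inE => /(_ i si).
have [i si Ai] : exists2 i, i \in s & ~ A i (Y i x).
  apply: contrapT => nex; move/negP : H; apply; rewrite inE => i /= si.
  by apply: contrapT => Ai; apply: nex; exists i.
by rewrite (big_rem i)//= indicE memNset// mul0r.
Qed.

(** [F] acts as a conditioning event: it will be a slice of the point configuration for the marks,
    and [setT] for the cell counts. *)
Lemma integral_prod_independent (R : realType) d (T : measurableType d)
    (P : probability T R) d' (T' : measurableType d') (I : choiceType)
    (Y : I -> T -> T') (s : seq I) (nu : I -> probability T' R) (F : set T) :
  uniq s -> (forall i, measurable_fun setT (Y i)) -> measurable F ->
  (forall A, (forall i, measurable (A i)) ->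
    P (F `&` \bigcap_(i in [set` s]) Y i @^-1` A i)
    = P F * \prod_(i <- s) nu i (A i))%E ->
  forall (phi : I -> T' -> R) (e : I -> R),
  (forall i, measurable_fun setT (phi i)) -> (forall i y, 0 <= phi i y) ->
  (forall i, \int[nu i]_y (phi i y)%:E = (e i)%:E)%E ->
  (\int[P]_x (\1_F x * \prod_(i <- s) phi i (Y i x))%:E
   = (fine (P F) * \prod_(i <- s) e i)%:E)%E.
Proof.
move=> us mY mF H; apply: ge0_integral_prod_comp => //.
  by rewrite fine_ge0.
move=> A mA.
have indicM B x : \1_F x * \1_B x = \1_(F `&` B) x :> R by rewrite indicI.
under eq_integral do rewrite prod_indic indicM.
have mYA : measurable (\bigcap_(i in [set` s]) Y i @^-1` A i).
  apply: fin_bigcap_measurable; first exact: finite_seq.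
  by move=> i _; rewrite -[X in measurable X]setTI; exact: mY.
rewrite integral_indic//; last exact: measurableI.
rewrite setIT; apply: (etrans (H A mA)).
rewrite EFinM fineK ?fin_num_measure//; congr (_ * _)%E.
rewrite -prodEFin; apply: eq_bigr => i _.
by rewrite fineK// fin_num_measure.
Qed.

(** * Finite partitions into cells, given as fibres of a map [kap], and the sigma-algebra of the
    points *)

Lemma fin_comp_indic (R : realType) (K : finType) (T : Type) (kap : T -> K)
    (g : K -> R) (x : T) :
  g (kap x) = \sum_k \1_(kap @^-1` [set k]) x * g k.
Proof.
rewrite (bigD1 (kap x))//= big1 ?addr0 => [|k kx].
  by rewrite indicE mem_set// mul1r.
by rewrite indicE memNset ?mul0r//= => /esym; exact/eqP.
Qed.

Lemma measurable_fin_comp (R : realType) (K : finType) d (T : measurableType d)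
    (kap : T -> K) (g : K -> R) :
  (forall k, measurable (kap @^-1` [set k])) ->
  measurable_fun setT (fun x => g (kap x)).
Proof.
move=> mkap; under eq_fun do rewrite fin_comp_indic.
by apply: measurable_sum => k; exact: measurable_funM.
Qed.

Lemma sigma_points_slice (R : realType) d (T : measurableType d)
    (N : T -> nat) (X : nat -> T -> R) (m : nat) (A : 'I_m -> set R) :
  (forall i, measurable (A i)) ->
  sigma_points N X (N @^-1` [set m] `&`
    \bigcap_(i in [set` index_enum 'I_m]) X i @^-1` A i).
Proof.
move=> mA.
pose G := [set E | exists i (B : set R), measurable B /\
         E = [set w | (i < N w)%N /\ B (X i w)]].
have mG i (B : set R) : measurable B ->
    @measurable _ (g_sigma_algebraType G) [set w | (i < N w)%N /\ B (X i w)].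
  by move=> mB; apply: sub_sigma_algebra; exists i, B.
(* The generators see [X i] only where [i < N]. Intersecting them over [i < m] forces [m <= N];
   removing the generator [m < N], taken with [setT], leaves exactly [N = m]. *)
rewrite (_ : _ `&` _ = (\bigcap_(i in [set` index_enum 'I_m])
    [set w | (i < N w)%N /\ A i (X i w)]) `\`
    [set w | (m < N w)%N /\ setT (X m w)]).
  apply: (@measurableD _ (g_sigma_algebraType G)); last exact: mG.
  apply: (@fin_bigcap_measurable _ (g_sigma_algebraType G)).
    exact: finite_seq.
  by move=> i _; exact: mG.
apply/seteqP; split => w.
  move=> [/= Nw H]; split => [i /= iI|[]].
    by split; [rewrite Nw|exact: H].
  by rewrite Nw ltnn.
move=> [H /= NmN]; have mN : (N w <= m)%N.
  by rewrite leqNgt; apply/negP => ?; exact: NmN.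
split; last by move=> i iI; have [] := H i iI.
apply/eqP; rewrite /= eqn_leq mN/= leqNgt; apply/negP => Nm.
have [] := H (Ordinal Nm) (mem_index_enum _).
by rewrite /= ltnn.
Qed.

(** * Averaging over the fading marks *)

Section marks.
Context (R : realType) d (T : measurableType d) (P : probability T R).
Variables (N : T -> nat) (X h : nat -> T -> R).
Hypothesis mN : measurable_fun setT N.
Hypothesis mX : forall i, measurable_fun setT (X i).
Hypothesis mh : forall i, measurable_fun setT (h i).
Hypothesis hmarks : iid_exp_marks P N X h.
Variables (n : nat) (kap : R -> 'I_n).
Hypothesis mkap : forall k, measurable (kap @^-1` [set k]).

(** Here [f] records the cell of each of the [m] points. For fixed [m] these finitely many events
    partition [N = m], and on each of them a function of cells and marks depends on the marks
    alone. *)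
Let slice m (f : {ffun 'I_m -> 'I_n}) : set T := N @^-1` [set m] `&`
  \bigcap_(i in [set` index_enum 'I_m]) X i @^-1` (kap @^-1` [set f i]).

Let measurable_slice m (f : {ffun 'I_m -> 'I_n}) : measurable (slice f).
Proof.
apply: measurableI; first by rewrite -[X in measurable X]setTI; exact: mN.
apply: fin_bigcap_measurable; first exact: finite_seq.
by move=> i _; rewrite -[X in measurable X]setTI; exact: mX.
Qed.

(** The slice lies in the sigma-algebra of the points and the other event in that of the marks, so
    they factor; mutual independence then splits the mark event. *)
Let slice_marks m (f : {ffun 'I_m -> 'I_n}) (A : 'I_m -> set R) :
  (forall i, measurable (A i)) ->
  (P (slice f `&` \bigcap_(i in [set` index_enum 'I_m]) h i @^-1` A i)
   = P (slice f) * \prod_i exponential_prob 1 (A i))%E.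
Proof.
move=> mA; have [hind hexp hXh] := hmarks.
rewrite hXh; last 2 first.
- by apply: sigma_points_slice => i; exact: mkap.
- pose G := [set E | exists i (B : set R), measurable B /\ E = h i @^-1` B].
  apply: (@fin_bigcap_measurable _ (g_sigma_algebraType G)).
    exact: finite_seq.
  by move=> i _; apply: sub_sigma_algebra; exists i, (A i).
congr (_ * _)%E.
rewrite (@mutually_independent_seq _ _ _ _ _ _ _ (fun i : 'I_m => h i))//.
- by apply: eq_bigr => i _; rewrite hexp.
- exact: (mutually_independent_inj val_inj hind).
- exact: index_enum_uniq.
Qed.

Let integral_slices m (G : 'I_n -> R -> R) (e : 'I_n -> R) :
  (forall k, measurable_fun setT (G k)) -> (forall k y, 0 <= G k y) ->
  (forall k, \int[exponential_prob (1 : R)]_y (G k y)%:E = (e k)%:E)%E ->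
  (\int[P]_w (\1_(N @^-1` [set m]) w * \prod_(i < m) G (kap (X i w)) (h i w))%:E
   = \sum_(f : {ffun 'I_m -> 'I_n}) (fine (P (slice f)) * \prod_i e (f i))%:E)%E.
Proof.
move=> mG G0 Ge.
transitivity (\int[P]_w \sum_(f : {ffun 'I_m -> 'I_n})
    (\1_(slice f) w * \prod_i G (f i) (h i w))%:E)%E.
  apply: eq_integral => w _; rewrite sumEFin; congr EFin.
  (* Each factor is expanded over the cells; distributing the product over the sums yields one term
     per assignment [f] of cells to points. *)
  under eq_bigr do rewrite (fin_comp_indic kap (G^~ _)).
  rewrite bigA_distr_bigA/= mulr_sumr; apply: eq_bigr => f _.
  rewrite big_split/= (prod_indic _ _ (fun i : 'I_m => X i)
    (fun i => kap @^-1` [set f i])) mulrA.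
  by rewrite /slice indicI.
rewrite ge0_integral_sum//; last 2 first.
- move=> f; apply/measurable_EFinP; apply: measurable_funM.
    exact: measurable_indic.
  by apply: measurable_prod => i _; exact: measurableT_comp.
- by move=> f w _; rewrite lee_fin mulr_ge0// prodr_ge0.
apply: eq_bigr => f _.
apply: (@integral_prod_independent _ _ _ P _ (measurableTypeR R) _
  (fun i : 'I_m => h i) (index_enum 'I_m) (fun=> exponential_prob (1 : R))
  (slice f) _ _ _ _ (fun i => G (f i)) (fun i => e (f i))) => //.
- exact: index_enum_uniq.
- by move=> i; exact: mh.
- exact: slice_marks.
- by move=> i; exact: mG.
Qed.

Lemma integral_marks (v : 'I_n -> R) : (forall k, 0 <= v k) ->
  (\int[P]_w (\prod_(i < N w) expR (- (v (kap (X i w)) * h i w)))%:E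
   = \int[P]_w (\prod_(i < N w) (1 + v (kap (X i w)))^-1)%:E)%E.
Proof.
move=> v0.
have vi k : 0 <= (1 + v k)^-1 by rewrite invr_ge0 addr_ge0.
apply: (@eq_integral_nat_index _ _ _ P N
  (fun m w => \prod_(i < m) expR (- (v (kap (X i w)) * h i w)))
  (fun m w => \prod_(i < m) (1 + v (kap (X i w)))^-1)) => //.
- move=> m; apply: measurable_prod => i _.
  apply: measurableT_comp => //; apply: measurableT_comp => //.
  apply: measurable_funM => //.
  by apply: (measurableT_comp (measurable_fin_comp v mkap)).
- move=> m; apply: measurable_prod => i _.
  exact: (measurableT_comp (measurable_fin_comp (fun k => (1 + v k)^-1) mkap)).
- by move=> m w; apply: prodr_ge0 => i _; exact: expR_ge0.
- by move=> m w; apply: prodr_ge0.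
move=> m.
(* The right-hand side is a sum over slices too, for functions of the marks
   that are constant. *)
rewrite (@integral_slices m (fun k y => expR (- (v k * y))) (fun k => (1 + v k)^-1)).
- rewrite -(@integral_slices m (fun k y => (1 + v k)^-1) (fun k => (1 + v k)^-1))//.
  move=> k; rewrite integral_cst//.
  rewrite [X in (_ * X)%E](_ : _ = 1%E); first by rewrite mule1.
  exact: (@probability_setT _ _ R (exponential_prob (1 : R))).
- by move=> k; exact: measurable_expRN.
- by move=> k y; exact: expR_ge0.
- by move=> k; exact: laplace_exponential.
Qed.

End marks.

(** * Cell counts of the Poisson process *)

Lemma measurable_pp_count (R : realType) d (T : measurableType d)
    (N : T -> nat) (X : nat -> T -> R) (B : set R) :
  measurable_fun setT N -> (forall i, measurable_fun setT (X i)) ->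
  measurable B -> measurable_fun setT (pp_count N X B).
Proof.
move=> mN mX mB.
apply: (@measurable_fun_nat_index _ _ _ _ N
  (fun m w => (\sum_(i < m) (X i w \in B))%N)) => //.
elim=> [|m IH].
  by under eq_fun do rewrite big_ord0; exact: measurable_cst.
under eq_fun do rewrite big_ord_recr/=.
apply: measurable_fun_addn => //.
have mXB : measurable_fun setT (fun w => X m w \in B).
  apply: (@measurable_fun_bool _ _ _ _ true).
  rewrite (_ : _ `&` _ = setT `&` X m @^-1` B); first exact: mX.
  apply/seteqP; split => w [_ /= H]; split=> //=.
    exact: set_mem H.
  exact: mem_set H.
by apply: measurableT_comp mXB.
Qed.

Section counts.
Context (R : realType) d (T : measurableType d) (P : probability T R).
Variables (N : T -> nat) (X : nat -> T -> R) (lam : R) (W : set R).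
Hypothesis mN : measurable_fun setT N.
Hypothesis mX : forall i, measurable_fun setT (X i).
Hypothesis lam0 : 0 <= lam.
Hypothesis mW : measurable W.
Hypothesis Wfin : (lebesgue_measure W < +oo)%E.
Hypothesis hPhi : homogeneous_poisson P lam W N X.
Variables (n : nat) (kap : R -> 'I_n).
Hypothesis mkap : forall k, measurable (kap @^-1` [set k]).
Local Notation B k := (kap @^-1` [set k]).

(** Exchange the products over points and cells: a point contributes exponent 1 to its own cell and
    0 to all others. *)
Lemma prod_points_count (r : 'I_n -> R) (w : T) :
  \prod_(i < N w) r (kap (X i w)) = \prod_k r k ^+ pp_count N X (B k) w.
Proof.
rewrite /pp_count; under [RHS]eq_bigr do rewrite -prodrXr.
rewrite exchange_big; apply: eq_bigr => i _.
rewrite (bigD1 (kap (X i w)))//= big1 => [|k kX].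
  by rewrite mem_set// expr1 mulr1.
by rewrite memNset ?expr0//= => /esym; exact/eqP.
Qed.

(** The cells are disjoint, so their counts are independent Poisson variables, and [pgf_poisson]
    evaluates each factor. *)
Lemma integral_prod_points (r : 'I_n -> R) : (forall k, 0 < r k) ->
  (\int[P]_w (\prod_(i < N w) r (kap (X i w)))%:E
   = (expR (- (lam * \sum_k fine (lebesgue_measure (B k `&` W)) * (1 - r k))))%:E)%E.
Proof.
move=> r0; have [hcount hind] := hPhi.
pose l k := lam * fine (lebesgue_measure (B k `&` W)).
have l0 k : 0 <= l k by rewrite mulr_ge0// fine_ge0.
transitivity (\int[P]_w (\1_(@setT T) w *
    \prod_(k <- index_enum 'I_n) r k ^+ pp_count N X (B k) w)%:E)%E.
  by apply: eq_integral => w _; rewrite prod_points_count indicT mul1r.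
rewrite (@integral_prod_independent _ _ _ P _ nat _
  (fun k : 'I_n => pp_count N X (B k)) (index_enum 'I_n)
  (fun k => poisson_prob (l k) 0%N) setT _ _ _ _
  (fun k j => r k ^+ j) (fun k => expR (- (l k * (1 - r k)))))//.
- rewrite probability_setT mul1r -expR_sum; congr (expR _)%:E.
  rewrite sumrN mulr_sumr; congr (- _); apply: eq_bigr => k _.
  by rewrite mulrA.
- exact: index_enum_uniq.
- by move=> k; apply: measurable_pp_count.
- move=> A mA; rewrite setTI probability_setT mul1e.
  rewrite mutually_independent_seq//.
  + by apply: eq_bigr => k _; rewrite hcount.
  + apply: hind => //.
    by move=> i j _ _ [x [/= <- <-]].
  + exact: index_enum_uniq.
- by move=> k j; rewrite exprn_ge0// ltW.
- by move=> k; apply: pgf_poisson.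
Qed.

(** Recognizes the exponent of [integral_prod_points] as an integral over the window. The finite
    measure of [W] ensures that [fine] loses nothing. *)
Lemma integral_fin_comp (r : 'I_n -> R) : (forall k, r k <= 1) ->
  (\int[lebesgue_measure]_(x in W) (1 - r (kap x))%:E
   = (\sum_k fine (lebesgue_measure (B k `&` W)) * (1 - r k))%:E)%E.
Proof.
move=> r1.
under eq_integral do rewrite (fin_comp_indic kap (fun k => 1 - r k)) -sumEFin.
rewrite ge0_integral_sum//; last 2 first.
- move=> k; apply/measurable_EFinP; apply: measurable_funM => //.
  exact: (@measurable_indic _ (measurableTypeR R) R W _ (mkap k)).
- by move=> k x _; rewrite lee_fin mulr_ge0// subr_ge0.
rewrite -sumEFin; apply: eq_bigr => k _.
under eq_integral do rewrite mulrC EFinM.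
rewrite ge0_integralZl//; last 2 first.
- apply/measurable_EFinP.
  exact: (@measurable_indic _ (measurableTypeR R) R W _ (mkap k)).
- by rewrite lee_fin subr_ge0.
rewrite integral_indic//; last exact: mkap.
rewrite EFinM muleC fineK//.
rewrite ge0_fin_numE//; apply: le_lt_trans Wfin.
apply: le_measure; rewrite ?inE.
- by apply: measurableI; first exact: mkap.
- exact: mW.
- exact: subIsetr.
Qed.

End counts.

(** * Laplace functional of the marked process, from simple to measurable functions *)

(** The cells are the level sets of [g], numbered by the position of the value in its finite
    range. *)
Lemma nnsfun_factor (R : realType) (g : {nnsfun R >-> R}) :
  exists n (kap : R -> 'I_n) (v : 'I_n -> R),
    [/\ forall k, measurable (kap @^-1` [set k]), forall k, 0 <= v k
      & forall x, g x = v (kap x)].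
Proof.
pose s : seq R := fset_set (range g).
have us : uniq s by exact: fset_uniq.
have sE y : (y \in s) = (y \in range g).
  by rewrite in_fset_set//; exact: fimfunP.
have gs x : (index (g x) s < size s)%N.
  by rewrite index_mem sE mem_set//; exists x.
exists (size s), (fun x => Ordinal (gs x)), (fun k => s`_k); split.
- move=> k; rewrite (_ : _ @^-1` _ = g @^-1` [set s`_k])//.
  apply/seteqP; split => x /=.
    by move=> <- /=; rewrite nth_index// -index_mem.
  by move=> gx; apply/val_inj; rewrite /= gx index_uniq.
- move=> k; have : s`_k \in range g by rewrite -sE mem_nth.
  by rewrite inE => -[x _ <-].
- by move=> x /=; rewrite nth_index// -index_mem.
Qed.

Section laplace.
Context (R : realType) d (T : measurableType d) (P : probability T R).
Variables (N : T -> nat) (X h : nat -> T -> R) (lam : R) (W : set R).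
Hypothesis mN : measurable_fun setT N.
Hypothesis mX : forall i, measurable_fun setT (X i).
Hypothesis mh : forall i, measurable_fun setT (h i).
Hypothesis lam0 : 0 <= lam.
Hypothesis mW : measurable W.
Hypothesis Wfin : (lebesgue_measure W < +oo)%E.
Hypothesis hPhi : homogeneous_poisson P lam W N X.
Hypothesis hmarks : iid_exp_marks P N X h.

(** The exponential density vanishes on negative reals. This gives the bound by 1 on the random
    exponentials, which holds only almost surely. *)
Lemma marks_ge0 : {ae P, forall w i, 0 <= h i w}.
Proof.
apply/ae_foralln => i; have [_ hexp _] := hmarks.
exists (h i @^-1` `]-oo, 0[); split.
- by rewrite -[X in measurable X]setTI; exact: mh.
- apply: (etrans (hexp i _ _)) => //; rewrite /exponential_prob integral0_eq// => x.
  by rewrite /= in_itv/= => x0; rewrite lt0_exponential_pdf.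
- by move=> w /= /negP; rewrite -ltNge in_itv.
Qed.

Let lap (s : R -> R) (w : T) : R :=
  expR (- \sum_(i < N w) s (X i w) * h i w).

Let measurable_lap s : measurable_fun setT s -> measurable_fun setT (lap s).
Proof.
move=> ms; apply: measurableT_comp => //; apply: measurableT_comp => //.
apply: (@measurable_fun_nat_index _ _ _ _ N
  (fun m w => \sum_(i < m) s (X i w) * h i w)) => // m.
apply: measurable_sum => i; apply: measurable_funM => //.
by apply: measurableT_comp.
Qed.

Let integral_lap_simple (g : {nnsfun R >-> R}) :
  (\int[P]_w (lap g w)%:E =
   (expR (- (lam * \int[lebesgue_measure]_(x in W) (1 - (1 + g x)^-1))))%:E)%E.
Proof.
have [n [kap [v [mkap v0 gE]]]] := nnsfun_factor g.
have v1 k : 0 < 1 + v k by rewrite ltr_pwDl.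
transitivity (\int[P]_w (\prod_(i < N w) expR (- (v (kap (X i w)) * h i w)))%:E)%E.
  apply: eq_integral => w _; rewrite /lap -sumrN expR_sum.
  by under eq_bigr do rewrite gE.
rewrite (integral_marks mN mX mh hmarks mkap v0).
rewrite (@integral_prod_points _ _ _ _ _ _ lam W mN mX lam0 hPhi n kap mkap
  (fun k => (1 + v k)^-1)); last by move=> k; rewrite invr_gt0.
congr (expR (- (_ * _)))%:E.
transitivity (\int[lebesgue_measure]_(x in W) (1 - (1 + v (kap x))^-1)).
  rewrite /Rintegral (@integral_fin_comp _ W mW Wfin n kap mkap
    (fun k => (1 + v k)^-1))// => k.
  by rewrite invf_le1// lerDl.
by under eq_Rintegral do rewrite -gE.
Qed.

Lemma laplace_interference (s : R -> R) :
  measurable_fun setT s -> (forall x, 0 <= s x) ->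
  (\int[P]_w (expR (- \sum_(i < N w) s (X i w) * h i w))%:E =
   (expR (- (lam * \int[lebesgue_measure]_(x in W) (1 - (1 + s x)^-1))))%:E)%E.
Proof.
move=> ms s0.
have msE : measurable_fun setT (EFin \o s) by exact/measurable_EFinP.
pose g := nnsfun_approx measurableT msE.
have gs x : g n x @[n --> \oo] --> s x.
  have gsE : (EFin \o g^~ x) n @[n --> \oo] --> (s x)%:E.
    by apply: cvg_nnsfun_approx => // y _; rewrite lee_fin.
  exact: (fine_cvg gsE).
have ml n : measurable_fun setT (fun w => (lap (g n) w)%:E).
  by apply/measurable_EFinP; exact: measurable_lap.
(* Dominated convergence with constant bound 1, integrable for a probability; each sum is finite, so
   it converges termwise. *)
have LHS : ((\int[P]_w (lap (g n) w)%:E) @[n --> \oo] -->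
    (\int[P]_w (lap s w)%:E))%E.
  have [] := @dominated_convergence _ _ _ P setT measurableT
    (fun n w => (lap (g n) w)%:E) (fun w => (lap s w)%:E) (cst 1%E) ml.
  - by apply/measurable_EFinP; exact: measurable_lap.
  - apply: aeW => w _; apply: cvg_EFin; first exact: nearW.
    apply: continuous_cvg; first exact: continuous_expR.
    apply: cvgN; apply: cvg_big => [|i _]; first exact: add_continuous.
    by apply: cvgM; [exact: gs|exact: cvg_cst].
  - exact: finite_measure_integrable_cst.
  - apply: filterS marks_ge0 => w h0 n _.
    rewrite /= lee_fin ger0_norm ?expR_ge0// expR_le1 oppr_le0 sumr_ge0// => i _.
    by rewrite mulr_ge0.
  - by move=> _ _.
(* The bound is again 1, now integrable because [W] has finite measure. *)
have RHS : (\int[lebesgue_measure]_(x in W) (1 - (1 + g n x)^-1) @[n --> \oo] -->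
    \int[lebesgue_measure]_(x in W) (1 - (1 + s x)^-1)).
  have mf (u : R -> R) : measurable_fun setT u -> (forall x, 0 <= u x) ->
      measurable_fun W (fun x : R => (1 - (1 + u x)^-1)%:E).
    move=> mu u0; apply/measurable_EFinP/measurable_funTS/measurable_funB => //.
    (* The inverse is a real power of a positive number, so its measurability follows from that of
       powers. *)
    rewrite (_ : (fun x => _) = (fun x => (1 + u x) `^ (-1))); last first.
      by apply/funext => x; rewrite powR_inv1// addr_ge0.
    have mu1 : measurable_fun setT (fun x => 1 + u x) by exact: measurable_funD.
    exact: (measurableT_comp (measurable_powR (-1)) mu1).
  have b01 (u : R) : 0 <= u -> 0 <= 1 - (1 + u)^-1 <= 1.
    move=> u0; have u1 : 0 < 1 + u by rewrite ltr_pwDl.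
    rewrite subr_ge0 invf_le1// lerDl u0/= gerBl invr_ge0 ltW//.
  have [] := @dominated_convergence _ _ _ lebesgue_measure W mW
    (fun n x => (1 - (1 + g n x)^-1)%:E) (fun x => (1 - (1 + s x)^-1)%:E) (cst 1%E).
  - by move=> n; exact: mf.
  - exact: mf.
  - apply: aeW => x _; apply: cvg_EFin; first exact: nearW.
    apply: cvgB; first exact: cvg_cst.
    apply: cvgV; first by rewrite gt_eqF// ltr_pwDl.
    by apply: cvgD; [exact: cvg_cst|exact: gs].
  - apply/integrableP; split; first exact: measurable_cst.
    rewrite (eq_integral (cst 1%E)) => [|x _]; last by rewrite /= normr1.
    by rewrite integral_cst// mul1e.
  - apply: aeW => x n _; rewrite /= lee_fin.
    have g0 : 0 <= g n x by [].
    by have /andP[/ger0_norm -> ->] := b01 _ g0.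
  - move=> iF _ H; apply: fine_cvg; rewrite fineK//.
    exact: integrable_fin_num.
have LHS' : ((\int[P]_w (lap (g n) w)%:E) @[n --> \oo] --> (expR
    (- (lam * \int[lebesgue_measure]_(x in W) (1 - (1 + s x)^-1))))%:E)%E.
  under eq_fun do rewrite integral_lap_simple.
  apply: cvg_EFin; first exact: nearW.
  apply: continuous_cvg; first exact: continuous_expR.
  by apply: cvgN; apply: cvgM => //; exact: cvg_cst.
exact: (cvg_unique _ LHS LHS').
Qed.
End laplace.

(** * The kernel [(1 + |u| ^ a)^-1] and its integrals over intervals *)

Lemma continuous_powR_norm (R : realType) (a : R) : 1 < a ->
  continuous (fun u : R => `|u| `^ a).
Proof.
move=> a1 x; have [->|x0] := eqVneq x 0.
  rewrite /continuous_at normr0 powR0 ?gt_eqF ?(lt_trans ltr01)//.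
  (* At 0 the derivability of powers does not apply; instead [|u| ^ a] is squeezed between 0 and
     [|u|] for [|u| <= 1], using [1 < a]. *)
  apply: (@squeeze_cvgr _ (nbhs (0 : R)) _ _ (cst 0) (fun u : R => `|u|)).
  - near=> u; rewrite powR_ge0/=.
    have u1 : `|u| <= 1 by near: u; exact: (@nbhs0_le _ R^o 1 ltr01).
    have [->|u0] := eqVneq u 0.
      by rewrite normr0 powR0// gt_eqF// (lt_trans ltr01).
    by apply: ge1r_powR; [rewrite normr_gt0 u0|exact: ltW].
  - exact: cvg_cst.
  - have := @norm_continuous _ R^o 0.
    by rewrite /continuous_at normr0.
rewrite /continuous_at.
apply: (@continuous_comp _ _ _ (fun u : R => `|u|) (fun u : R => u `^ a)).
  exact: norm_continuous.
apply: differentiable_continuous; apply/derivable1_diffP.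
by apply: derivable_powR; rewrite in_itv/= andbT normr_gt0.
Unshelve. all: by end_near. Qed.

Lemma continuous_inv_powR (R : realType) (a : R) : 1 < a ->
  continuous (fun u : R => (1 + `|u| `^ a)^-1).
Proof.
move=> a1 x; apply: cvgV.
  by rewrite gt_eqF// ltr_pwDl// powR_ge0.
by apply: cvgD; [exact: cvg_cst|exact: continuous_powR_norm].
Qed.

Section continuous_Rintegral.
Variables (R : realType) (k : R -> R).
Hypothesis ck : continuous k.
Local Notation mu := (@lebesgue_measure R).

Lemma continuous_itv_integrable (a b : R) :
  mu.-integrable `[a, b] (EFin \o k).
Proof.
apply: continuous_compact_integrable; first exact: segment_compact.
exact: continuous_subspaceT.
Qed.

Lemma Rintegral_itv_cat (a b c : R) : a <= b -> b <= c ->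
  \int[mu]_(x in `[a, c]) k x
  = \int[mu]_(x in `[a, b]) k x + \int[mu]_(x in `[b, c]) k x.
Proof.
move=> ab bc; apply/eqP; rewrite addrC -subr_eq; apply/eqP.
rewrite Rintegral_itvB//; last exact: continuous_itv_integrable.
(* The difference leaves an interval open at [b], and adding the single point [b] does not change
   the integral. *)
apply: Rintegral_itv_obnd_cbnd.
by apply: integrableS (continuous_itv_integrable b c) => //; exact: subset_itv_oc_cc.
Qed.

Lemma Rintegral_itv_even (a b : R) : (forall x, k (- x) = k x) -> a <= b ->
  \int[mu]_(x in `[a, b]) k x = \int[mu]_(x in `[- b, - a]) k x.
Proof.
move=> keven ab; congr fine; rewrite integration_by_substitution_oppr//.
  by apply: eq_integral => x _ /=; rewrite keven.
exact: continuous_subspaceT.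
Qed.

(** Substitution [u = (x - c) / z], increasing because [0 < z]; the factor [z] cancels its constant
    derivative. *)
Lemma integral_affine (a b c z : R) : 0 < z -> a <= b ->
  (\int[mu]_(x in `[a, b]) (k ((x - c) / z))%:E
   = (z * \int[mu]_(x in `[(a - c) / z, (b - c) / z]) k x)%:E)%E.
Proof.
move=> z0 ab; pose F (x : R) : R := (x - c) / z.
have F' : (F^`())%classic = cst z^-1.
  apply/funext => x; rewrite derive1Mr; last exact: ex_derive.
  by rewrite derive1E deriveB// derive_id derive_cst subr0 mul1r.
have cF : continuous F.
  move=> x; apply: cvgM; last exact: cvg_cst.
  by apply: cvgB; [exact: cvg_id|exact: cvg_cst].
have dF x : derivable F x 1 by apply: ex_derive.
have := @integration_by_substitution_increasing R F k a b ab.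
rewrite F' => H.
rewrite EFinM /Rintegral fineK; last first.
  by apply: integrable_fin_num => //; exact: continuous_itv_integrable.
rewrite H//; first last.
- exact: continuous_subspaceT.
- split => //.
  + by apply: cvg_at_right_filter; exact: cF.
  + by apply: cvg_at_left_filter; exact: cF.
- exact: is_cvg_cst.
- exact: is_cvg_cst.
- by move=> x _; exact: cvg_cst.
- by move=> x y _ _ xy; rewrite /F ltr_pM2r ?invr_gt0// ltrD2r.
have ckF : continuous (k \o F).
  by move=> x; apply: continuous_comp; [exact: cF|exact: ck].
rewrite -integralZl//; last first.
  apply: continuous_compact_integrable; first exact: segment_compact.
  apply: continuous_subspaceT => x; apply: cvgM; [exact: ckF|exact: cvg_cst].
apply: eq_integral => x _; rewrite -EFinM; congr EFin.
by rewrite fctE/= mulrCA divff ?gt_eqF// mulr1.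
Qed.

End continuous_Rintegral.

Lemma integral_calX (R : realType) (a z Rx c : R) (y : 'cV[R]_2) :
  1 < a -> 0 < z -> 0 < Rx -> enorm y = `|c| ->
  (\int[lebesgue_measure]_(x in `[(- Rx)%R, Rx])
     ((1 + `|(x - c) / z| `^ a)^-1)%:E = (z * calX a z y Rx)%:E)%E.
Proof.
move=> a1 z0 R0 yc.
pose k (u : R) := (1 + `|u| `^ a)^-1.
have ck : continuous k by exact: continuous_inv_powR.
have keven u : k (- u) = k u by rewrite /k normrN.
rewrite (@integral_affine _ k)//; last by lra.
congr (_ * _)%:E; rewrite /calX yc.
have gE t : g_circ a t = \int[lebesgue_measure]_(u in `[0, t]) k u.
  apply: eq_Rintegral => u; rewrite inE/= in_itv/= => /andP[u0 _].
  by rewrite /k ger0_norm.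
(* The sign of [c] is removed by evenness of the kernel: for [c < 0] the interval is reflected. *)
transitivity (\int[lebesgue_measure]_(u in `[- ((Rx + `|c|) / z), (Rx - `|c|) / z]) k u).
  have [c0|c0] := leP 0 c; first by rewrite ger0_norm// -opprD mulNr.
  rewrite ltr0_norm//.
  rewrite Rintegral_itv_even//; last first.
    by rewrite ler_pM2r ?invr_gt0//; lra.
  by rewrite -[- ((- Rx - c) / z)]mulNr opprB opprK [c + Rx]addrC opprK.
have zi : 0 < z^-1 by rewrite invr_gt0.
have p0 : 0 <= (Rx + `|c|) / z by rewrite mulr_ge0 ?addr_ge0// ltW.
(* If [|c| <= Rx] the interval contains 0: split there and reflect the negative half. *)
have [cR|cR] := leP `|c| Rx.
  rewrite mulr1 mulr0 subr0.
  have q0 : 0 <= (Rx - `|c|) / z by rewrite mulr_ge0 ?subr_ge0// ltW.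
  rewrite (@Rintegral_itv_cat _ _ ck _ 0) ?oppr_le0// Rintegral_itv_even ?oppr_le0//.
  by rewrite oppr0 opprK !gE.
(* Otherwise the interval lies left of 0; its reflection is the difference of two intervals starting
   at 0. *)
have q0 : 0 <= - ((Rx - `|c|) / z).
  by rewrite -mulNr mulr_ge0 ?opprB ?subr_ge0// ltW.
have qp : - ((Rx - `|c|) / z) <= (Rx + `|c|) / z.
  by rewrite -mulNr ler_pM2r//; lra.
rewrite mulr0 mulr1 addr0 Rintegral_itv_even//; last by rewrite lerNl.
rewrite opprK !gE (@Rintegral_itv_cat _ _ ck 0 (- ((Rx - `|c|) / z)) ((Rx + `|c|) / z))//.
by rewrite addrAC subrr add0r.
Qed.

(** * Distances and path loss on the road *)

Lemma enorm_e_x (R : realType) (c : R) : enorm (c *: e_x) = `|c|.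
Proof.
rewrite /enorm /e_x !big_ord_recl big_ord0 !mxE /= !(mulr1, mulr0, expr0n, addr0).
by rewrite sqrtr_sqr.
Qed.

Lemma enorm_gt0 (R : realType) (y : 'cV[R]_2) : y != 0 -> 0 < enorm y.
Proof.
move=> y0; rewrite /enorm sqrtr_gt0 lt_def sumr_ge0 ?andbT; last first.
  by move=> i _; exact: sqr_ge0.
apply: contra_neq y0 => /eqP.
rewrite psumr_eq0; last by move=> i _; exact: sqr_ge0.
move=> /allP H; apply/matrixP => i j; rewrite ord1 mxE; apply/eqP.
by have := H i (mem_index_enum _); rewrite sqrf_eq0.
Qed.

Lemma powR_radius (R : realType) (a b D : R) : 1 < a -> 0 < b -> 0 < D ->
  (b `^ (1 / a) * D) `^ a = b * D `^ a.
Proof.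
move=> a1 b0 D0; rewrite powRM ?powR_ge0 ?ltW// -powRrM.
by rewrite divfK ?gt_eqF ?(lt_trans ltr01)// powRr1 ?ltW.
Qed.

(** The constant [A] cancels, and the scaled path loss is [w / q] with [w = z ^ a] and
    [q = |x - c| ^ a]; then [1 - 1 / (1 + w / q) = 1 / (1 + q / w)]. At [x = c] the default value of
    the power would make the left side 0 and the right side 1. *)
Lemma pathloss_ratio (R : realType) (A a b c x : R) (y : 'cV[R]_2) :
  1 < a -> 0 < b -> 0 < A -> 0 < enorm (c *: e_x - y) -> x != c ->
  let z := b `^ (1 / a) * enorm (c *: e_x - y) in
  1 - (1 + b / pathloss_suburban A a y (c *: e_x)
           * pathloss_suburban A a (x *: e_x) (c *: e_x))^-1
  = (1 + `|(x - c) / z| `^ a)^-1.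
Proof.
move=> a1 b0 A0 D0 xc z.
have z0 : 0 < z by rewrite mulr_gt0// powR_gt0.
have zE : z `^ a = b * enorm (c *: e_x - y) `^ a by exact: powR_radius.
clearbody z.
have d0 : 0 < `|x - c| by rewrite normr_gt0 subr_eq0.
rewrite /pathloss_suburban -scalerBl enorm_e_x distrC !powRN.
have w0 : 0 < z `^ a by rewrite powR_gt0.
have q0 : 0 < `|x - c| `^ a by rewrite powR_gt0.
have <- : (`|x - c| `^ a) / z `^ a = `|(x - c) / z| `^ a.
  rewrite normrM normfV (gtr0_norm z0) powRM ?invr_ge0 ?ltW//.
  by rewrite -[z^-1]powR_inv1 ?ltW// [(z `^ _) `^ _]powRAC powR_inv1 ?powR_ge0.
have -> : b / (A * (enorm (c *: e_x - y) `^ a)^-1)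
    * (A * (`|x - c| `^ a)^-1) = z `^ a / `|x - c| `^ a.
  rewrite zE; field.
  by rewrite !gt_eqF ?powR_gt0.
move: (z `^ a) (`|x - c| `^ a) w0 q0 => w q w0 q0.
by field; rewrite !gt_eqF ?addr_gt0.
Qed.

(** * The Laplace transform of the road interference *)

Theorem proposition1 (R : realType) (d : measure_display)
    (T : measurableType d) (P : probability T R)
    (alpha beta A0 Rx lambda_x p_I x_rx0 x_tx0 y_tx0 : R)
    (N : {RV P >-> nat}) (X h : nat -> {RV P >-> R})
    (halpha : 1 < alpha) (hbeta : 0 < beta) (hA0 : 0 < A0) (hRx : 0 < Rx)
    (hlambda : 0 < lambda_x) (hp_I : 0 <= p_I <= 1)
    (x_rx := x_rx0 *: e_x) (x_tx := x_tx0 *: e_x + y_tx0 *: e_y)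
    (hroad : x_tx0 * y_tx0 = 0) (hneq : x_tx <> x_rx)
    (hPhi : homogeneous_poisson P (p_I * lambda_x) [set x | `|x| <= Rx] N X)
    (hfading : iid_exp_marks P N X h)
    (zeta_s := beta `^ (1 / alpha) * enorm (x_rx - x_tx)) :
  P_circ P (pathloss_suburban A0 alpha) beta x_tx x_rx N X h
  = (expR (- (p_I * lambda_x * zeta_s * calX alpha zeta_s x_rx Rx)))%:E.
Proof.
have D0 : 0 < enorm (x_rx - x_tx).
  by apply: enorm_gt0; rewrite subr_eq0 eq_sym; exact/eqP.
have z0 : 0 < zeta_s by rewrite mulr_gt0// powR_gt0.
have lam0 : 0 <= p_I * lambda_x.
  by case/andP : hp_I => p0 _; rewrite mulr_ge0// ltW.
have WE : [set x : R | `|x| <= Rx] = `[- Rx, Rx]%classic.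
  by apply/seteqP; split => x /=; rewrite in_itv/= ler_norml.
rewrite WE in hPhi.
have mW : measurable `[- Rx, Rx]%classic by exact: measurable_itv.
have Wfin : (lebesgue_measure `[(- Rx)%R, Rx]%classic < +oo)%E.
  by rewrite lebesgue_measure_itv/=; case: ifP => _; rewrite ?ltry.
pose b := beta / pathloss_suburban A0 alpha x_tx x_rx.
(* With this scaling, the exponent of the transform is minus the sum of [s (X i w) * h i w]. *)
pose s x := b * pathloss_suburban A0 alpha (x *: e_x) x_rx.
have s0 x : 0 <= s x.
  by rewrite /s /b /pathloss_suburban !(mulr_ge0, invr_ge0, powR_ge0)// ltW.
have ms : measurable_fun setT s.
  have md : measurable_fun setT (fun x : R => `|x_rx0 - x|).
    by apply: measurableT_comp => //; exact: measurable_funB.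
  have mp := measurableT_comp (measurable_powR (- alpha)) md.
  rewrite (_ : s = (fun x => b * (A0 * `|x_rx0 - x| `^ (- alpha)))).
    by apply: measurable_funM => //; exact: measurable_funM.
  apply/funext => x.
  by rewrite /s /pathloss_suburban -scalerBl enorm_e_x.
rewrite /P_circ expectation.unlock.
transitivity (\int[P]_w (expR (- \sum_(i < N w) s (X i w) * h i w))%:E)%E.
  apply: eq_integral => w _; congr (expR _)%:E.
  rewrite /interference mulNr mulr_sumr; congr (- _); apply: eq_bigr => i _.
  by rewrite mulrCA mulrC.
rewrite (@laplace_interference _ _ _ P N X h _ _ _ _ _ lam0 mW Wfin hPhi hfading _ ms s0)//.
congr (expR (- _))%:E; rewrite -[in RHS]mulrA; congr (_ * _).
rewrite /Rintegral [X in fine X](_ : _ = (zeta_s * calX alpha zeta_s x_rx Rx)%:E)//.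
rewrite -(@integral_calX _ alpha zeta_s Rx x_rx0 x_rx)//; last exact: enorm_e_x.
pose k x := (1 + `|(x - x_rx0) / zeta_s| `^ alpha)^-1.
have mDc : measurable (`[- Rx, Rx]%classic `\ x_rx0).
  by apply: measurableD => //; exact: measurable_set1.
have mk : measurable_fun (`[- Rx, Rx]%classic `\ x_rx0) (fun x => (k x)%:E).
  apply/measurable_EFinP/measurable_funTS; apply: continuous_measurable_fun => x.
  apply: (@continuous_comp _ _ _ (fun x => (x - x_rx0) / zeta_s)
    (fun u => (1 + `|u| `^ alpha)^-1)); last exact: continuous_inv_powR.
  by apply: cvgM; [apply: cvgB; [exact: cvg_id|exact: cvg_cst]|exact: cvg_cst].
(* Off the receiver the two integrands agree, which also transfers measurability from the continuous
   kernel [k]. *)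
have sk : {in `[- Rx, Rx]%classic `\ x_rx0,
    (fun x => (k x)%:E) =1 (fun x => (1 - (1 + s x)^-1)%:E)}.
  move=> x; rewrite inE => -[_ /= /eqP xc]; congr EFin.
  by rewrite [RHS]pathloss_ratio.
(* The junk value of the path loss at [x_rx] is excised with a null set. *)
rewrite -[RHS](@integral_setD1 _ _ x_rx0)//.
rewrite -[LHS](@integral_setD1 _ _ x_rx0)//; last exact: eq_measurable_fun sk mk.
by apply: eq_integral => x xD; rewrite -sk.
Qed.
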